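(* Let $\zeta\in\Bbbk$ be a primitive fourth root of unity. Let $g,x$ denote the generators of $T(4,2,1)$ and $G,X$ the generators of the Hopf algebra $K$ defined in the context. Then the bilinear form on $K\times T(4,2,1)$ defined on bases by $$\langle X^iG^j,\,x^kg^\ell\rangle=\delta_{i,k}\,\zeta^{j\ell}\qquad(0\le i,k\le1,\ 0\le j,\ell\le3)$$ is a perfect duality. Therefore $T(4,2,1)^*\cong K$.
   Context: $\Bbbk$ is an algebraically closed field of characteristic $0$. $T(4,2,1)$ is the Hopf algebra generated by a grouplike element $g$ and an element $x$ with $\Delta(x)=g\otimes x+x\otimes1$, subject to $g^4=1$, $x^2=g^2-1$, $gx=-xg$; it has basis $\{x^kg^\ell\}_{0\le k\le1,\,0\le\ell\le3}$. $K$ is the algebra generated by $G,X$ subject to $G^4=1$, $X^2=0$, $GX=\zeta XG$; it is $8$-dimensional with basis $\{X^iG^j\}_{0\le i\le1,\,0\le j\le3}$, and is a Hopf algebra with $$\Delta(G)=G\otimes G-2XG^3\otimes XG,\quad \Delta(X)=G^2\otimes X+X\otimes1,\quad \epsilon(G)=1,\ \epsilon(X)=0,\quad S(G)=G^3,\ S(X)=XG^2.$$ A bilinear form $\langle\ ,\ \rangle$ on $H\times L$, for Hopf algebras $H,L$, is a duality if for all $u,v\in H$ and $z,w\in L$: $\langle uv,z\rangle=\langle u,z_{(1)}\rangle\langle v,z_{(2)}\rangle$, $\langle u,zw\rangle=\langle u_{(1)},z\rangle\langle u_{(2)},w\rangle$, $\langle1,z\rangle=\epsilon_L(z)$, $\langle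 u,1\rangle=\epsilon_H(u)$, $\langle S_H(u),z\rangle=\langle u,S_L(z)\rangle$. The duality is perfect if the induced maps $H\to L^*$ and $L\to H^*$ are injective. *)

(* Defs.v *)
From HB Require Import structures.
From mathcomp Require Import all_boot all_algebra falgebra.

Set Implicit Arguments.
Unset Strict Implicit.
Unset Printing Implicit Defensive.

Import GRing.Theory.
Local Open Scope ring_scope.

(* An element of U (x) V is written as a finite formal sum of pure tensors,
   [:: (u1, v1); ...; (un, vn)] standing for u1 (x) v1 + ... + un (x) vn.  Two
   formal sums denote the same element of U (x) V iff every bilinear map
   identifies them (universal property of the tensor product). *)
Definition tensor_eq (k : fieldType) (U V : lmodType k) (s t : seq (U * V)) : Prop :=
  forall (W : lmodType k) (b : {bilinear U -> V -> W}),
    \sum_(p <- s) b p.1 p.2 = \sum_(p <- t) b p.1 p.2.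

Definition trilinear (k : fieldType) (U V W Z : lmodType k)
    (m : U -> V -> W -> Z) : Prop :=
  [/\ forall v w, linear (fun u => m u v w),
      forall u w, linear (fun v => m u v w) &
      forall u v, linear (m u v)].

Definition tensor3_eq (k : fieldType) (U V W : lmodType k)
    (s t : seq (U * V * W)) : Prop :=
  forall (Z : lmodType k) (m : U -> V -> W -> Z), trilinear m ->
    \sum_(p <- s) m p.1.1 p.1.2 p.2 = \sum_(p <- t) m p.1.1 p.1.2 p.2.

(* [comul u] is a Sweedler representative of Delta(u): the sum of
   u_(1) (x) u_(2) is indexed by the pairs p <- comul u, with u_(1) = p.1 and
   u_(2) = p.2.  All axioms on [comul] are up to [tensor_eq]. *)
HB.mixin Record Algebra_isHopf (k : fieldType) A of GRing.Algebra k A := {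
  comul : A -> seq (A * A);
  counit : A -> k;
  antipode : A -> A;
  comul_linear : forall (a : k) (u v : A),
    tensor_eq (comul (a *: u + v)) ([seq (a *: p.1, p.2) | p <- comul u] ++ comul v);
  comulA : forall u : A,
    tensor3_eq [seq (q.1, q.2, p.2) | p <- comul u, q <- comul p.1]
               [seq (p.1, q.1, q.2) | p <- comul u, q <- comul p.2];
  comul1 : tensor_eq (comul 1) [:: (1, 1)];
  comulM : forall u v : A,
    tensor_eq (comul (u * v))
              [seq (p.1 * q.1, p.2 * q.2) | p <- comul u, q <- comul v];
  counit_linear : scalar counit;
  counit1 : counit 1 = 1;
  counitM : forall u v : A, counit (u * v) = counit u * counit v;
  comul_counitl : forall u : A, \sum_(p <- comul u) counit p.1 *: p.2 = u;
  comul_counitr : forall u : A, \sum_(p <- comul u) counit p.2 *: p.1 = u;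
  antipode_linear : linear antipode;
  antipodel : forall u : A, \sum_(p <- comul u) antipode p.1 * p.2 = (counit u)%:A;
  antipoder : forall u : A, \sum_(p <- comul u) p.1 * antipode p.2 = (counit u)%:A
}.

#[short(type="hopfAlgType")]
HB.structure Definition HopfAlgebra (k : fieldType) :=
  { A of GRing.Algebra k A & Algebra_isHopf k A }.

#[short(type="finHopfAlgType")]
HB.structure Definition FinHopfAlgebra (k : fieldType) :=
  { A of Falgebra k A & Algebra_isHopf k A }.

Definition grouplike (k : fieldType) (H : hopfAlgType k) (g : H) : Prop :=
  tensor_eq (comul g) [:: (g, g)] /\ counit g = 1.

Definition hopf_isomorphic (k : fieldType) (H L : hopfAlgType k) : Prop :=
  exists f : {lrmorphism H -> L},
    [/\ bijective f,
        forall u, tensor_eq (comul (f u)) [seq (f p.1, f p.2) | p <- comul u],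
        forall u, counit (f u) = counit u &
        forall u, f (antipode u) = antipode (f u)].

Lemma linear_linfun (k : fieldType) (U V : vectType k) (f : U -> V) :
  linear f -> linfun f =1 f.
Proof.
move=> lf; pose F : {linear U -> V} := HB.pack f (GRing.isLinear.Build _ _ _ _ f lf).
exact: (lfunE F).
Qed.

Lemma linear_sumZ (k : fieldType) (U V : lmodType k) (f : U -> V) (I : Type)
    (r : seq I) (c : I -> k) (u : I -> U) :
  linear f -> f (\sum_(i <- r) c i *: u i) = \sum_(i <- r) c i *: f (u i).
Proof.
move=> lf; pose F : {linear U -> V} := HB.pack f (GRing.isLinear.Build _ _ _ _ f lf).
by rewrite -[f]/(F : U -> V) linear_sum; apply: eq_bigr => i _; rewrite linearZ.
Qed.

Lemma bilinear_tensor_eq (k : fieldType) (U V W : lmodType k) (s t : seq (U * V))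
    (b : U -> V -> W) :
    tensor_eq s t -> (forall v, linear (b^~ v)) -> (forall u, linear (b u)) ->
  \sum_(p <- s) b p.1 p.2 = \sum_(p <- t) b p.1 p.2.
Proof.
move=> st bl br.
pose B : {bilinear U -> V -> W} :=
  HB.pack b (bilinear_isBilinear.Build _ _ _ _ _ _ b (pair bl br)).
exact: (st W B).
Qed.

Lemma exchange_big4 (k : nmodType) (I J P Q : Type) (r : seq I) (s : seq J)
    (t : seq P) (u : seq Q) (F : I -> J -> P -> Q -> k) :
  \sum_(i <- r) \sum_(j <- s) \sum_(p <- t) \sum_(q <- u) F i j p q =
  \sum_(p <- t) \sum_(q <- u) \sum_(i <- r) \sum_(j <- s) F i j p q.
Proof.
under eq_bigr => i _ do rewrite exchange_big.
rewrite exchange_big; apply: eq_bigr => p _ /=.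
under eq_bigr => i _ do rewrite exchange_big.
by rewrite exchange_big.
Qed.

(* The dual Hopf algebra H^* of a finite-dimensional Hopf algebra H. *)
Section Dual.
Variables (k : fieldType) (H : finHopfAlgType k).

Definition dual : Type := 'Hom(H, k^o).

HB.instance Definition _ := Vector.on dual.

Implicit Types f g h : dual.

Definition dual_mul f g : dual :=
  linfun (fun z : H => \sum_(p <- comul z) f p.1 * g p.2 : k^o).

Definition dual_one : dual := linfun (counit : H -> k^o).

(* f(z w) = sum_i e_i^*(z) f(e_i w), where (e_i) is a basis of H, that is,
   Delta(f) = sum_i e_i^* (x) f(e_i -). *)
Definition dual_comul f : seq (dual * dual) :=
  [seq (linfun (coord (vbasis {:H}) i : H -> k^o),
        linfun (fun w : H => f ((vbasis {:H})`_i * w) : k^o)) | i : 'I_(\dim {:H})].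

Definition dual_counit f : k := f 1.

Definition dual_antipode f : dual := linfun (fun z : H => f (antipode z)).

Let e (i : 'I_(\dim {:H})) : H := (vbasis {:H})`_i.
Let e' (i : 'I_(\dim {:H})) : dual := linfun (coord (vbasis {:H}) i : H -> k^o).

Let e'E i z : e' i z = coord (vbasis {:H}) i z.
Proof. by rewrite linear_linfun //; exact: linearP. Qed.

Let coordE (z : H) : z = \sum_i (e' i z : k) *: e i.
Proof.
rewrite {1}[z](coord_vbasis (memvf z)).
by apply: eq_bigr => i _; rewrite e'E.
Qed.

Let dualE f : f = \sum_i (f (e i) : k) *: e' i.
Proof.
apply/lfunP => z; rewrite {1}[z]coordE linear_sum sum_lfunE.
by apply: eq_bigr => i _; rewrite linearZ scale_lfunE; exact: mulrC.
Qed.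

Lemma dual_mulE f g z : dual_mul f g z = \sum_(p <- comul z) f p.1 * g p.2.
Proof.
rewrite linear_linfun // => a u v.
rewrite (bilinear_tensor_eq (b := fun x y => f x * g y : k^o) (comul_linear a u v)).
- rewrite big_cat big_map /= scaler_sumr; congr (_ + _).
  by apply: eq_bigr => p _; rewrite linearZ scalerAl.
- by move=> y b x x'; rewrite linearP mulrDl scalerAl.
- by move=> x b y y'; rewrite linearP mulrDr scalerAr.
Qed.

Lemma dual_oneE z : dual_one z = counit z.
Proof. by rewrite linear_linfun //; exact: counit_linear. Qed.

Lemma dual_antipodeE f z : dual_antipode f z = f (antipode z).
Proof.
by rewrite linear_linfun // => a u v; rewrite antipode_linear linearP.
Qed.

Lemma dual_comulE f z w : \sum_(p <- dual_comul f) p.1 z * p.2 w = f (z * w).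
Proof.
rewrite big_map big_enum /= [in RHS](coordE z) mulr_suml linear_sum.
apply: eq_bigr => i _; rewrite -scalerAl linearZ /= [X in _ * X]linear_linfun //.
by move=> a u v; rewrite mulrDr -scalerAr linearP.
Qed.

Lemma dual_tensor_eq (s t : seq (dual * dual)) :
    (forall z w, \sum_(p <- s) p.1 z * p.2 w = \sum_(p <- t) p.1 z * p.2 w) ->
  tensor_eq s t.
Proof.
move=> st W b.
have E (r : seq (dual * dual)) : \sum_(p <- r) b p.1 p.2 =
    \sum_i \sum_j (\sum_(p <- r) p.1 (e i) * p.2 (e j) : k) *: b (e' i) (e' j).
  under [RHS]eq_bigr => i _ do
    (under eq_bigr => j _ do rewrite scaler_suml; rewrite exchange_big).
  rewrite exchange_big; apply: eq_bigr => p _.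
  rewrite {1}[p.1]dualE linear_sumlz; apply: eq_bigr => i _.
  rewrite linearZl_LR {1}[p.2]dualE linear_sumr scaler_sumr.
  by apply: eq_bigr => j _; rewrite linearZr_LR scalerA.
by rewrite !E; apply: eq_bigr => i _; apply: eq_bigr => j _; rewrite st.
Qed.

Lemma dual_tensor3_eq (s t : seq (dual * dual * dual)) :
    (forall x y z, \sum_(p <- s) p.1.1 x * p.1.2 y * p.2 z =
                   \sum_(p <- t) p.1.1 x * p.1.2 y * p.2 z) ->
  tensor3_eq s t.
Proof.
move=> st Z m [m1 m2 m3].
have E (r : seq (dual * dual * dual)) : \sum_(p <- r) m p.1.1 p.1.2 p.2 =
    \sum_i \sum_j \sum_l (\sum_(p <- r) p.1.1 (e i) * p.1.2 (e j) * p.2 (e l) : k)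
       *: m (e' i) (e' j) (e' l).
  under [RHS]eq_bigr => i _ do (under eq_bigr => j _ do
    (under eq_bigr => l _ do rewrite scaler_suml; rewrite exchange_big);
    rewrite exchange_big).
  rewrite exchange_big; apply: eq_bigr => p _.
  rewrite {1}[p.1.1]dualE (linear_sumZ _ _ _ (m1 _ _)); apply: eq_bigr => i _.
  rewrite {1}[p.1.2]dualE (linear_sumZ _ _ _ (m2 _ _)) scaler_sumr.
  apply: eq_bigr => j _; rewrite scalerA.
  rewrite {1}[p.2]dualE (linear_sumZ _ _ _ (m3 _ _)) scaler_sumr.
  by apply: eq_bigr => l _; rewrite scalerA.
by rewrite !E; do 3!(apply: eq_bigr => ? _); rewrite st.
Qed.

Fact dual_mulA : associative dual_mul.
Proof.
move=> f g h; apply/lfunP => z; rewrite !dual_mulE.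
under eq_bigr => p _ do
  (rewrite dual_mulE mulr_sumr; under eq_bigr => q _ do rewrite mulrA).
under [RHS]eq_bigr => p _ do rewrite dual_mulE mulr_suml.
have tri : trilinear (fun u v w : H => f u * g v * h w : k^o).
  split=> x y a u v; rewrite linearP.
  - by rewrite !mulrDl !scalerAl.
  - by rewrite mulrDr mulrDl -scalerAr -!scalerAl.
  - by rewrite mulrDr scalerAr.
have := comulA z _ _ tri.
by rewrite !big_allpairs_dep /= => ->.
Qed.

Fact dual_mul1f : left_id dual_one dual_mul.
Proof.
move=> f; apply/lfunP => z; rewrite dual_mulE -[in RHS](comul_counitl z) linear_sum.
by apply: eq_bigr => p _; rewrite dual_oneE linearZ.
Qed.

Fact dual_mulf1 : right_id dual_one dual_mul.
Proof.
move=> f; apply/lfunP => z; rewrite dual_mulE -[in RHS](comul_counitr z) linear_sum.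
by apply: eq_bigr => p _; rewrite dual_oneE linearZ; exact: mulrC.
Qed.

Fact dual_mulDl : left_distributive dual_mul +%R.
Proof.
move=> f g h; apply/lfunP => z; rewrite add_lfunE !dual_mulE -big_split.
by apply: eq_bigr => p _; rewrite add_lfunE mulrDl.
Qed.

Fact dual_mulDr : right_distributive dual_mul +%R.
Proof.
move=> f g h; apply/lfunP => z; rewrite add_lfunE !dual_mulE -big_split.
by apply: eq_bigr => p _; rewrite add_lfunE mulrDr.
Qed.

Fact dual_one_neq0 : dual_one != 0 :> dual.
Proof.
apply/eqP => /lfunP/(_ 1); rewrite dual_oneE counit1 zero_lfunE => /eqP.
by rewrite oner_eq0.
Qed.

HB.instance Definition _ := GRing.Zmodule_isNzRing.Build dual
  dual_mulA dual_mul1f dual_mulf1 dual_mulDl dual_mulDr dual_one_neq0.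

Fact dual_scalerAl (a : k) (f g : dual) : a *: (f * g) = a *: f * g.
Proof.
apply/lfunP => z; rewrite scale_lfunE !dual_mulE scaler_sumr.
by apply: eq_bigr => p _; rewrite scale_lfunE scalerAl.
Qed.

HB.instance Definition _ := GRing.Lmodule_isLalgebra.Build k dual dual_scalerAl.

Fact dual_scalerAr (a : k) (f g : dual) : a *: (f * g) = f * (a *: g).
Proof.
apply/lfunP => z; rewrite scale_lfunE !dual_mulE scaler_sumr.
by apply: eq_bigr => p _; rewrite scale_lfunE scalerAr.
Qed.

HB.instance Definition _ := GRing.Lalgebra_isAlgebra.Build k dual dual_scalerAr.
HB.instance Definition _ := Algebra_isFalgebra.Build k dual.

Let dual1E z : (1 : dual) z = counit z.
Proof. exact: dual_oneE. Qed.

Let dualME f g z : (f * g) z = \sum_(p <- comul z) f p.1 * g p.2.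
Proof. exact: dual_mulE. Qed.

Fact dual_comul_linear (a : k) (f g : dual) :
  tensor_eq (dual_comul (a *: f + g))
    ([seq (a *: p.1, p.2) | p <- dual_comul f] ++ dual_comul g).
Proof.
apply: dual_tensor_eq => z w; rewrite dual_comulE big_cat /= dual_comulE big_map add_lfunE scale_lfunE.
rewrite -(dual_comulE f) scaler_sumr; congr (_ + _).
by apply: eq_bigr => p _; rewrite scale_lfunE scalerAl.
Qed.

Fact dual_comulA (f : dual) :
  tensor3_eq [seq (q.1, q.2, p.2) | p <- dual_comul f, q <- dual_comul p.1]
             [seq (p.1, q.1, q.2) | p <- dual_comul f, q <- dual_comul p.2].
Proof.
apply: dual_tensor3_eq => x y z; rewrite !big_allpairs_dep /=.
under eq_bigr => p _ do rewrite -mulr_suml dual_comulE.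
under [RHS]eq_bigr => p _ do
  (under eq_bigr => q _ do rewrite -mulrA; rewrite -mulr_sumr dual_comulE).
by rewrite !dual_comulE mulrA.
Qed.

Fact dual_comul1 : tensor_eq (dual_comul 1) [:: (1, 1)].
Proof.
apply: dual_tensor_eq => z w; rewrite big_seq1 dual_comulE /= !dual1E.
by rewrite counitM.
Qed.

Fact dual_comulM (f g : dual) :
  tensor_eq (dual_comul (f * g))
    [seq (p.1 * q.1, p.2 * q.2) | p <- dual_comul f, q <- dual_comul g].
Proof.
apply: dual_tensor_eq => z w; rewrite big_allpairs_dep dual_comulE dualME /=.
rewrite (bilinear_tensor_eq (b := fun x y => f x * g y : k^o) (comulM z w)); first last.
- by move=> x b y y'; rewrite linearP mulrDr scalerAr.
- by move=> y b x x'; rewrite linearP mulrDl scalerAl.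
rewrite big_allpairs_dep /=.
transitivity (\sum_(a <- comul z) \sum_(b <- comul w)
   \sum_(p <- dual_comul f) \sum_(q <- dual_comul g)
     (p.1 a.1 * q.1 a.2) * (p.2 b.1 * q.2 b.2) : k).
  apply: eq_bigr => a _; apply: eq_bigr => b _.
  rewrite -!dual_comulE big_distrl; apply: eq_bigr => p _.
  by rewrite big_distrr; apply: eq_bigr => q _; rewrite /= mulrACA.
rewrite exchange_big4; apply: eq_bigr => p _; apply: eq_bigr => q _.
rewrite !dualME big_distrl; apply: eq_bigr => a _.
by rewrite big_distrr.
Qed.

Fact dual_counit_linear : scalar dual_counit.
Proof. by move=> a f g; rewrite /dual_counit add_lfunE scale_lfunE. Qed.

Fact dual_counit1 : dual_counit 1 = 1.
Proof. by rewrite /dual_counit dual1E counit1. Qed.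

Fact dual_counitM (f g : dual) : dual_counit (f * g) = dual_counit f * dual_counit g.
Proof.
rewrite /dual_counit dualME.
rewrite (bilinear_tensor_eq (b := fun x y => f x * g y : k^o) comul1) ?big_seq1 //.
- by move=> y b x x'; rewrite linearP mulrDl scalerAl.
- by move=> x b y y'; rewrite linearP mulrDr scalerAr.
Qed.

Fact dual_comul_counitl (f : dual) :
  \sum_(p <- dual_comul f) dual_counit p.1 *: p.2 = f.
Proof.
apply/lfunP => z; rewrite sum_lfunE -[in RHS](mul1r z) -dual_comulE.
by apply: eq_bigr => p _; rewrite scale_lfunE.
Qed.

Fact dual_comul_counitr (f : dual) :
  \sum_(p <- dual_comul f) dual_counit p.2 *: p.1 = f.
Proof.
apply/lfunP => z; rewrite sum_lfunE -[in RHS](mulr1 z) -dual_comulE.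
by apply: eq_bigr => p _; rewrite scale_lfunE; exact: mulrC.
Qed.

Fact dual_antipode_linear : linear dual_antipode.
Proof.
move=> a f g; apply/lfunP => z.
by rewrite add_lfunE scale_lfunE !dual_antipodeE add_lfunE scale_lfunE.
Qed.

Fact dual_antipodel (f : dual) :
  \sum_(p <- dual_comul f) dual_antipode p.1 * p.2 = (dual_counit f)%:A.
Proof.
apply/lfunP => z; rewrite sum_lfunE scale_lfunE dual1E.
under eq_bigr => p _ do rewrite dualME.
rewrite exchange_big /=.
under eq_bigr => a _ do
  (under eq_bigr => p _ do rewrite dual_antipodeE; rewrite dual_comulE).
by rewrite -linear_sum antipodel linearZ; exact: mulrC.
Qed.

Fact dual_antipoder (f : dual) :
  \sum_(p <- dual_comul f) p.1 * dual_antipode p.2 = (dual_counit f)%:A.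
Proof.
apply/lfunP => z; rewrite sum_lfunE scale_lfunE dual1E.
under eq_bigr => p _ do rewrite dualME.
rewrite exchange_big /=.
under eq_bigr => a _ do
  (under eq_bigr => p _ do rewrite dual_antipodeE; rewrite dual_comulE).
by rewrite -linear_sum antipoder linearZ; exact: mulrC.
Qed.

HB.instance Definition _ := Algebra_isHopf.Build k dual
  dual_comul_linear dual_comulA dual_comul1 dual_comulM
  dual_counit_linear dual_counit1 dual_counitM
  dual_comul_counitl dual_comul_counitr
  dual_antipode_linear dual_antipodel dual_antipoder.

End Dual.

Section Duality.
Variables (k : fieldType) (H L : hopfAlgType k) (b : {bilinear H -> L -> k | *%R & *%R}).

Definition duality : Prop :=
  [/\ forall (u v : H) (z : L), b (u * v) z = \sum_(p <- comul z) b u p.1 * b v p.2,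
      forall (u : H) (z w : L), b u (z * w) = \sum_(p <- comul u) b p.1 z * b p.2 w,
      forall z : L, b 1 z = counit z,
      forall u : H, b u 1 = counit u &
      forall (u : H) (z : L), b (antipode u) z = b u (antipode z)].

Definition perfect_duality : Prop :=
  [/\ duality,
      forall u v : H, b u =1 b v -> u = v &
      forall z w : L, b^~ z =1 b^~ w -> z = w].

End Duality.

(* A is the algebra generated by a and b subject to the relations [rel]: it
   satisfies them and is universal among the algebras with two elements that do. *)
Definition presented_by (k : fieldType) (rel : forall B : algType k, B -> B -> Prop)
    (A : algType k) (a b : A) : Prop :=
  [/\ rel A a b,
      forall (B : algType k) (a' b' : B), rel B a' b' ->
        exists f : {lrmorphism A -> B}, f a = a' /\ f b = b' &
      forall (B : algType k) (f f' : {lrmorphism A -> B}),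
        f a = f' a -> f b = f' b -> f =1 f'].

Definition T421_rel (k : fieldType) (B : algType k) (g x : B) : Prop :=
  [/\ g ^+ 4 = 1, x ^+ 2 = g ^+ 2 - 1 & g * x = - (x * g)].

(* The counit and the antipode of T(4,2,1) are determined by the comultiplication.
   The monomial bases of T(4,2,1) and of K are consequences of the presentations,
   so they are not assumed. *)
Record is_T421 (k : fieldType) (T : hopfAlgType k) (g x : T) : Prop := {
  T421_presented : presented_by (@T421_rel k) g x;
  T421_g : grouplike g;
  T421_x : tensor_eq (comul x) [:: (g, x); (x, 1)]
}.

Definition K_rel (k : fieldType) (zeta : k) (B : algType k) (G X : B) : Prop :=
  [/\ G ^+ 4 = 1, X ^+ 2 = 0 & G * X = zeta *: (X * G)].

Record is_K (k : fieldType) (zeta : k) (K : hopfAlgType k) (G X : K) : Prop := {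
  K_presented : presented_by (K_rel zeta) G X;
  K_comulG : tensor_eq (comul G) [:: (G, G); (- 2 *: (X * G ^+ 3), X * G)];
  K_comulX : tensor_eq (comul X) [:: (G ^+ 2, X); (X, 1)];
  K_counitG : counit G = 1;
  K_counitX : counit X = 0;
  K_antipodeG : antipode G = G ^+ 3;
  K_antipodeX : antipode X = X * G ^+ 2
}.

(* A bilinear form with these values exists iff they are compatible with the
   linear relations between the monomials, and it is unique since these span. *)
Definition on_bases (k : fieldType) (zeta : k) (K T : algType k) (G X : K) (g x : T)
    (b : K -> T -> k) : Prop :=
  forall (i m : 'I_2) (j l : 'I_4),
    b (X ^+ i * G ^+ j) (x ^+ m * g ^+ l) = (i == m)%:R * zeta ^+ (j * l).

(* Main.v *)
(* [dual T] satisfies the relations of [K]: the two functionals G : x^m g^l -> [m = 0] zeta^l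
   and X : x^m g^l -> [m = 1] are matrix coefficients of two-dimensional representations of
   T(4,2,1), which makes them well defined and gives their coproducts.  The presentation of [K] then
   yields an algebra map K -> dual T, which respects comultiplication because it does so on
   generators, and hence the antipode; evaluating it gives the pairing.  A discrete
   Fourier inversion at the fourth roots of unity shows that the pairing is perfect, and
   perfectness forces the algebra map to be bijective by a dimension count. *)
Require Import Defs.
From HB Require Import structures.
From mathcomp Require Import all_boot all_algebra falgebra.

Set Implicit Arguments.
Unset Strict Implicit.
Unset Printing Implicit Defensive.

Import GRing.Theory.
Local Open Scope ring_scope.

(** * Presentations and spanning monomials *)

(* The map from [A] to the subalgebra generated by [a] and [b], composed with the inclusion,
   is the identity by uniqueness; hence [a] and [b] generate [A]. *)
Lemma presented_by_vspace (k : fieldType) (rel : forall B : algType k, B -> B -> Prop)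
    (A : falgType k) (a b : A) (V : {vspace A}) :
    (forall (B C : algType k) (f : {lrmorphism B -> C}) (u v : B),
       injective f -> rel C (f u) (f v) -> rel B u v) ->
    presented_by rel a b ->
    1 \in V -> {in V, forall v, a * v \in V} -> {in V, forall v, b * v \in V} ->
  V = fullv.
Proof.
move=> rel_inj [rel_ab ex_lift uniq_lift] V1 aV bV.
pose S := agenv_aspace <<[:: a; b]>>.
have S1 : 1 \in S by rewrite memvE sub1_agenv.
have Sa : a \in S by rewrite (subvP (sub_agenv _)) // memv_span ?inE ?eqxx.
have Sb : b \in S by rewrite (subvP (sub_agenv _)) // memv_span ?inE ?eqxx ?orbT.
(* A subalgebra carries its own unit [algid]; it is the unit of [A] because 1 lies in [S]. *)
have valM : monoid_morphism (vsval : subvs_of S -> A).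
  by split=> //; apply/eqP; rewrite algid_eq1.
have valL : linear (vsval : subvs_of S -> A) by [].
pose val' : {lrmorphism subvs_of S -> A} :=
  HB.pack (vsval : subvs_of S -> A)
    (GRing.isLinear.Build _ _ _ _ _ valL) (GRing.isMonoidMorphism.Build _ _ _ valM).
have rel_S : rel (subvs_of S) (Subvs Sa) (Subvs Sb).
  exact: (rel_inj _ _ val' _ _ val_inj).
have [f [fa fb]] := ex_lift _ _ _ rel_S.
have idE : val' \o f =1 idfun by apply: uniq_lift; rewrite /= ?fa ?fb.
(* [S] lies in any subspace that contains 1 and is stable under left multiplication by its
   generators. *)
have SV : (S <= V)%VS.
  apply: agenv_sub_modl; first by rewrite -memvE.
  apply/prodvP => u v /=; rewrite span_cons span_seq1.
  move=> /memv_addP[_ /vlineP[c ->] [_ /vlineP[d ->] ->]] Vv.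
  by rewrite mulrDl -!scalerAl memvD ?memvZ ?aV ?bV.
apply/eqP; rewrite eqEsubv subvf; apply/subvP => u _.
by apply: (subvP SV); rewrite -[u]/(idfun u) -idE subvsP.
Qed.

(** This allows the relations to be pulled back along the inclusion of a subalgebra, as
    [presented_by_vspace] asks. *)
Lemma T421_rel_inj (k : fieldType) (B C : algType k) (f : {lrmorphism B -> C}) (u v : B) :
  injective f -> T421_rel (f u) (f v) -> T421_rel u v.
Proof.
move=> f_inj [g4 x2 gx]; split; apply: f_inj.
- by rewrite rmorphXn g4 rmorph1.
- by rewrite rmorphB rmorph1 !rmorphXn.
- by rewrite rmorphN !rmorphM.
Qed.

Lemma K_rel_inj (k : fieldType) (zeta : k) (B C : algType k)
    (f : {lrmorphism B -> C}) (u v : B) :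
  injective f -> K_rel zeta (f u) (f v) -> K_rel zeta u v.
Proof.
move=> f_inj [g4 x2 gx]; split; apply: f_inj.
- by rewrite rmorphXn g4 rmorph1.
- by rewrite rmorphXn x2 rmorph0.
- by rewrite linearZ /= !rmorphM.
Qed.

Definition monomials (k : fieldType) (A : falgType k) (g x : A) : {vspace A} :=
  (\sum_(m : 'I_2 * 'I_4) <[x ^+ m.1 * g ^+ m.2]>)%VS.

Lemma monomialsP (k : fieldType) (A : falgType k) (g x u : A) :
  u \in monomials g x ->
  exists c : 'I_2 -> 'I_4 -> k, u = \sum_i \sum_j c i j *: (x ^+ i * g ^+ j).
Proof.
case/memv_sumP => v v_line ->.
have /fin_all_exists[c vE] (m : 'I_2 * 'I_4) : exists c, v m = c *: (x ^+ m.1 * g ^+ m.2).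
  by have /vlineP := v_line m isT.
exists (fun i j => c (i, j)); rewrite pair_big /=.
by apply: eq_bigr => -[i j] _; rewrite vE.
Qed.

Lemma mem_monomials (k : fieldType) (A : falgType k) (g x : A) (m l : nat) :
  g ^+ 4 = 1 -> (m < 2)%N -> x ^+ m * g ^+ l \in monomials g x.
Proof.
move=> g4 lt_m2; rewrite memvE.
rewrite (sumv_sup (Ordinal lt_m2, inord (l %% 4))) //=.
by rewrite inordK ?ltn_mod // expr_mod.
Qed.

Lemma monomials_stable (k : fieldType) (A : falgType k) (g x : A) (h : A) :
    (forall (m : 'I_2) (l : 'I_4), h * (x ^+ m * g ^+ l) \in monomials g x) ->
  {in monomials g x, forall v, h * v \in monomials g x}.
Proof.
move=> hV _ /monomialsP[c ->]; rewrite mulr_sumr memv_suml // => i _.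
by rewrite mulr_sumr memv_suml // => j _; rewrite -scalerAr memvZ.
Qed.

Lemma monomials_ind (k : fieldType) (A : falgType k) (g x : A) (P : A -> Prop) :
    monomials g x = fullv ->
    (forall c u v, P u -> P v -> P (c *: u + v)) ->
    (forall (m : 'I_2) (l : 'I_4), P (x ^+ m * g ^+ l)) ->
  forall u, P u.
Proof.
move=> gen Plin Pmon u.
(* [Plin] gives no zero case, so 0 is written as -u + u for the monomial u = 1. *)
have P0 : P 0.
  rewrite -(addNr (x ^+ 0 * g ^+ 0)) -scaleN1r.
  exact: (Plin _ _ _ (Pmon 0 0) (Pmon 0 0)).
have PD v w : P v -> P w -> P (v + w) by move=> Pv Pw; rewrite -[v]scale1r; exact: Plin.
have /monomialsP[c ->] : u \in monomials g x by rewrite gen memvf.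
elim/big_ind: _ => // i _; elim/big_ind: _ => // j _.
by rewrite -[_ *: _]addr0; exact: Plin.
Qed.

(** The relations rewrite towards the normal form [x ^+ m * g ^+ l]: [g] passes [x] up to a sign,
    and [x ^+ 2] becomes a difference of powers of [g]. The span is thus stable under left
    multiplication by both generators. *)
Lemma T421_monomials (k : fieldType) (T : falgType k) (g x : T) :
  presented_by (@T421_rel k) g x -> monomials g x = fullv.
Proof.
move=> T_gx; have [[g4 x2 gx] _ _] := T_gx.
apply: (presented_by_vspace (@T421_rel_inj k) T_gx).
- by have := mem_monomials (m := 0) x 0 g4 isT; rewrite mulr1.
- apply: monomials_stable => m l; have := mem_monomials (m := m) x l.+1 g4 (ltn_ord m).
  case: m => -[|[|//]] lt_m2 /=; first by rewrite !mul1r exprS.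
  by rewrite expr1 mulrA gx mulNr rpredN -mulrA -exprS.
- apply: monomials_stable => -[[|[|//]] lt_m2] l /=.
    by rewrite mul1r -[x in x * _]expr1 mem_monomials.
  rewrite expr1 mulrA -expr2 x2 mulrBl mul1r -exprD rpredB //.
    by have := mem_monomials (m := 0) x (2 + l) g4 isT; rewrite mul1r.
  by have := mem_monomials (m := 0) x l g4 isT; rewrite mul1r.
Qed.

Lemma K_monomials (k : fieldType) (zeta : k) (K : falgType k) (G X : K) :
  presented_by (K_rel zeta) G X -> monomials G X = fullv.
Proof.
move=> K_GX; have [[G4 X2 GX] _ _] := K_GX.
apply: (presented_by_vspace (@K_rel_inj k zeta) K_GX).
- by have := mem_monomials (m := 0) X 0 G4 isT; rewrite mulr1.
- apply: monomials_stable => m l; have := mem_monomials (m := m) X l.+1 G4 (ltn_ord m).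
  case: m => -[|[|//]] lt_m2 /=; first by rewrite !mul1r exprS.
  by rewrite expr1 mulrA GX -scalerAl -mulrA -exprS; exact: memvZ.
- apply: monomials_stable => -[[|[|//]] lt_m2] l /=.
    by rewrite mul1r -[X in X * _]expr1 mem_monomials.
  by rewrite expr1 mulrA -expr2 X2 mul0r mem0v.
Qed.

(** * Coproducts of products, and inverses of Hopf algebra maps *)

(** The representatives chosen by [comul] can be replaced one factor at a time, since a bilinear map
    stays bilinear after multiplying its arguments by fixed elements. *)
Lemma tensor_eq_comulM (k : fieldType) (H : hopfAlgType k) (u v : H) (s t : seq (H * H)) :
    tensor_eq (comul u) s -> tensor_eq (comul v) t ->
  tensor_eq (comul (u * v)) [seq (p.1 * q.1, p.2 * q.2) | p <- s, q <- t].
Proof.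
move=> us vt W b; rewrite (comulM u v _ b) !big_allpairs_dep /=.
rewrite exchange_big [RHS]exchange_big /=.
transitivity (\sum_(q <- comul v) \sum_(p <- s) b (p.1 * q.1) (p.2 * q.2)).
  apply: eq_bigr => q _.
  apply: (bilinear_tensor_eq (b := fun y z => b (y * q.1) (z * q.2)) us).
  - by move=> z c y y'; rewrite mulrDl -scalerAl linearPl.
  - by move=> y c z z'; rewrite mulrDl -scalerAl linearPr.
rewrite exchange_big [RHS]exchange_big /=; apply: eq_bigr => p _.
apply: (bilinear_tensor_eq (b := fun y z => b (p.1 * y) (p.2 * z)) vt).
- by move=> z c y y'; rewrite mulrDr -scalerAr linearPl.
- by move=> y c z z'; rewrite mulrDr -scalerAr linearPr.
Qed.

(* [antipode \o f] and [f \o antipode] are a right and a left convolution inverse of [f]. *)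
Lemma hopf_morph_antipode (k : fieldType) (H L : hopfAlgType k) (f : {lrmorphism H -> L}) :
    (forall u, tensor_eq (comul (f u)) [seq (f p.1, f p.2) | p <- comul u]) ->
    (forall u, counit (f u) = counit u) ->
  forall u, f (antipode u) = antipode (f u).
Proof.
move=> fD fe u; apply/esym.
have tri : trilinear (fun a b c : H => f (antipode a) * f b * antipode (f c)).
  split=> y z c v w.
  - by rewrite antipode_linear linearP !mulrDl -!scalerAl.
  - by rewrite linearP mulrDr mulrDl -scalerAr -scalerAl.
  - by rewrite linearP antipode_linear mulrDr -scalerAr.
have := comulA u _ _ tri; rewrite !big_allpairs_dep /= => assoc.
transitivity (\sum_(p <- comul u) \sum_(q <- comul p.1)
    f (antipode q.1) * f q.2 * antipode (f p.2)).
  rewrite -{1}[u]comul_counitl linear_sum.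
  under eq_bigr => p _ do rewrite linearZ /=.
  rewrite (linear_sumZ _ _ _ antipode_linear); apply: eq_bigr => p _.
  rewrite -mulr_suml; under eq_bigr => q _ do rewrite -rmorphM.
  by rewrite -linear_sum antipodel linearZ /= rmorph1 -scalerAl mul1r.
rewrite assoc -{2}[u]comul_counitr (linear_sumZ _ _ _ antipode_linear) linear_sum.
apply: eq_bigr => p _; rewrite linearZ /=.
under eq_bigr => q _ do rewrite -mulrA.
rewrite -mulr_sumr.
have := bilinear_tensor_eq (b := fun y z : L => y * antipode z) (fD p.2).
rewrite antipoder big_map /= => <-.
- by rewrite fe -scalerAr mulr1.
- by move=> z c y y'; rewrite mulrDl -scalerAl.
- by move=> y c z z'; rewrite antipode_linear mulrDr -scalerAr.
Qed.

(** Testing the coproduct condition of [f] on bilinear maps composed with the inverse gives the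
    condition for the inverse. The antipode is handled by [hopf_morph_antipode]. *)
Lemma hopf_isomorphic_inv (k : fieldType) (H L : hopfAlgType k) (f : {lrmorphism H -> L}) :
    bijective f ->
    (forall u, tensor_eq (comul (f u)) [seq (f p.1, f p.2) | p <- comul u]) ->
    (forall u, counit (f u) = counit u) ->
  hopf_isomorphic L H.
Proof.
move=> [h fK hK] fD fe.
have h_lin : linear h := can2_linear fK hK.
pose h' : {lrmorphism L -> H} := HB.pack h
  (GRing.isLinear.Build _ _ _ _ _ h_lin)
  (GRing.isMonoidMorphism.Build _ _ h (can2_monoid_morphism fK hK)).
exists h'; split; first by exists f.
- move=> v W b; rewrite big_map /=.
  have := bilinear_tensor_eq (b := fun y z => b (h' y) (h' z)) (fD (h v)).
  rewrite hK big_map /= => ->.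
  + by apply: eq_bigr => p _; rewrite !fK.
  + by move=> z c y y'; rewrite h_lin linearPl.
  + by move=> y c z z'; rewrite h_lin linearPr.
- by move=> v; rewrite -fe hK.
- move=> v; apply: (can_inj fK); rewrite hK.
  by rewrite (hopf_morph_antipode fD fe) hK.
Qed.

(** * Representations of T(4,2,1) and functionals on it *)

Lemma ord2_ind (P : 'I_2 -> Prop) : P 0 -> P 1 -> forall i, P i.
Proof.
move=> P0 P1 [[|[|//]] lt_i].
- by have -> : Ordinal lt_i = 0 by exact: val_inj.
- by have -> : Ordinal lt_i = 1 by exact: val_inj.
Qed.

Section DualT421.
Variables (k : fieldType) (T : finHopfAlgType k) (g x : T).
Hypothesis T_gx : is_T421 g x.

Let T_span : monomials g x = fullv := T421_monomials (T421_presented T_gx).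

(* [g] acts by diag(c, -c) and [x] by the antidiagonal matrix with entries [c ^+ 2 - 1]
   and [1], whose square is the scalar [c ^+ 2 - 1]. *)
Lemma T421_rep (c : k) : c ^+ 4 = 1 ->
  exists f : {lrmorphism T -> 'M[k]_2}, forall (m : 'I_2) (l : nat),
    let A := f (x ^+ m * g ^+ l) in
    [/\ A 0 0 = (m == 0)%:R * c ^+ l, A 1 1 = (m == 0)%:R * (- c) ^+ l,
        A 1 0 = (m == 1)%:R * c ^+ l &
        A 0 1 = (m == 1)%:R * ((c ^+ 2 - 1) * (- c) ^+ l)].
Proof.
move=> c4.
(* [D a b] is diagonal and [N a b] antidiagonal, with [a] in the top row. The product rules below
   reduce every matrix identity to one between these parameters. *)
pose D (a b : k) : 'M[k]_2 := \matrix_(i, j) ((i == j)%:R * (if i == 0 then a else b)).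
pose N (a b : k) : 'M[k]_2 := \matrix_(i, j) ((i != j)%:R * (if i == 0 then a else b)).
have D0 : D 1 1 = 1 by apply/matrixP => i j; rewrite !mxE if_same mulr1.
have DD a b a' b' : D a b * D a' b' = D (a * a') (b * b').
  apply/matrixP; apply: ord2_ind; apply: ord2_ind; rewrite !mxE big_ord_recl big_ord1 !mxE /=;
  by rewrite !(mul1r, mul0r, mulr0, addr0, add0r).
have ND a b a' b' : N a b * D a' b' = N (a * b') (b * a').
  apply/matrixP; apply: ord2_ind; apply: ord2_ind; rewrite !mxE big_ord_recl big_ord1 !mxE /=;
  by rewrite !(mul1r, mul0r, mulr0, addr0, add0r).
have DN a b a' b' : D a b * N a' b' = N (a * a') (b * b').
  apply/matrixP; apply: ord2_ind; apply: ord2_ind; rewrite !mxE big_ord_recl big_ord1 !mxE /=;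
  by rewrite !(mul1r, mul0r, mulr0, addr0, add0r).
have NN a b a' b' : N a b * N a' b' = D (a * b') (b * a').
  apply/matrixP; apply: ord2_ind; apply: ord2_ind; rewrite !mxE big_ord_recl big_ord1 !mxE /=;
  by rewrite !(mul1r, mul0r, mulr0, addr0, add0r).
have DX a b l : D a b ^+ l = D (a ^+ l) (b ^+ l).
  by elim: l => [|l IHl]; rewrite ?expr0 ?D0 // exprS IHl DD -!exprS.
have rel : T421_rel (D c (- c)) (N (c ^+ 2 - 1) 1).
  split.
  - by rewrite DX exprNn c4 mulr1 -signr_odd expr0 D0.
  - rewrite expr2 NN DX sqrrN mulr1 mul1r -D0.
    by apply/matrixP => i j; rewrite !mxE -mulrBr; case: ifP.
  - rewrite DN ND; apply/matrixP => i j; rewrite !mxE -mulrN; congr (_ * _).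
    by case: ifP => _; rewrite ?mulr1 ?mul1r // mulrN opprK mulrC.
have [_ /(_ _ _ _ rel)[f [fg fx]] _] := T421_presented T_gx.
have fE (m l : nat) : f (x ^+ m * g ^+ l) = N (c ^+ 2 - 1) 1 ^+ m * D (c ^+ l) ((- c) ^+ l).
  by rewrite rmorphM !rmorphXn -DX -fg -fx.
exists f; apply: ord2_ind => l; rewrite fE; move=> A; rewrite {}/A.
  by rewrite expr0 mul1r !mxE /= !mul1r !mul0r.
by rewrite expr1 ND !mxE /= !mul1r !mul0r.
Qed.

Lemma T421_comul_grouplike (l : nat) : tensor_eq (comul (g ^+ l)) [:: (g ^+ l, g ^+ l)].
Proof.
elim: l => [|l IHl]; first exact: comul1.
by rewrite exprS; exact: (tensor_eq_comulM (T421_g T_gx).1 IHl).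
Qed.

Lemma T421_comul_skew (l : nat) :
  tensor_eq (comul (x * g ^+ l)) [:: (g ^+ l.+1, x * g ^+ l); (x * g ^+ l, g ^+ l)].
Proof.
have := tensor_eq_comulM (T421_x T_gx) (T421_comul_grouplike l).
by rewrite /= mul1r -exprS.
Qed.

Lemma T421_counit (m : 'I_2) (l : nat) : counit (x ^+ m * g ^+ l) = (m == 0)%:R.
Proof.
have eM : {morph (counit : T -> k) : u v / u * v >-> u * v} := counitM.
have eg : counit (g ^+ l) = 1.
  elim: l => [|l IHl]; first exact: counit1.
  by rewrite exprS eM IHl (T421_g T_gx).2 mulr1.
case: m => -[|[|//]] lt_m /=; first by rewrite mul1r.
rewrite expr1 eM eg mulr1.
(* Applied to the coproduct of [x], the counit axiom reads x = counit(g) x + counit(x) 1, which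
   forces counit(x) = 0. *)
have := comul_counitl x.
rewrite (bilinear_tensor_eq (b := fun u v : T => counit u *: v) (T421_x T_gx)).
- rewrite big_cons big_seq1 /= (T421_g T_gx).2 scale1r => /(canRL (addKr _)).
  by rewrite addNr => /eqP; rewrite scaler_eq0 oner_eq0 orbF => /eqP.
- by move=> v a u u'; rewrite counit_linear scalerDl scalerA.
- by move=> u a v v'; rewrite scalerDr !scalerA mulrC.
Qed.

Lemma T421_linear_eq (q q' : T -> k^o) :
    linear q -> linear q' ->
    (forall (m : 'I_2) (l : nat), q (x ^+ m * g ^+ l) = q' (x ^+ m * g ^+ l)) ->
  q =1 q'.
Proof.
move=> q_lin q'_lin qq'; apply: (monomials_ind T_span) => [c u v qu qv|m l].
  by rewrite q_lin q'_lin qu qv.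
exact: qq'.
Qed.

Lemma dual_bilinear_tensor_eq (f h : dual T) (s t : seq (T * T)) :
  tensor_eq s t -> \sum_(p <- s) f p.1 * h p.2 = \sum_(p <- t) f p.1 * h p.2.
Proof.
move=> st; apply: (bilinear_tensor_eq (b := fun y z => f y * h z : k^o) st).
- by move=> y b u v; rewrite linearP mulrDl scalerAl.
- by move=> y b u v; rewrite linearP mulrDr scalerAr.
Qed.

Lemma T421_dualM_grouplike (f h : dual T) l :
  (f * h) (g ^+ l) = f (g ^+ l) * h (g ^+ l).
Proof.
by rewrite dual_mulE (dual_bilinear_tensor_eq _ _ (T421_comul_grouplike l)) big_seq1.
Qed.

Lemma T421_dualM_skew (f h : dual T) l :
  (f * h) (x * g ^+ l) = f (g ^+ l.+1) * h (x * g ^+ l) + f (x * g ^+ l) * h (g ^+ l).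
Proof.
rewrite dual_mulE (dual_bilinear_tensor_eq _ _ (T421_comul_skew l)).
by rewrite big_cons big_seq1.
Qed.

Variables (zeta : k).
Hypothesis zeta_prim : 4.-primitive_root zeta.

Lemma prim4_sqr : zeta ^+ 2 = -1.
Proof.
have /eqP : (zeta ^+ 2 - 1) * (zeta ^+ 2 + 1) = 0.
  by rewrite -subr_sqr expr1n -exprM (prim_expr_order zeta_prim) subrr.
rewrite mulf_eq0 subr_eq0 -(prim_order_dvd zeta_prim) /= addr_eq0.
by move/eqP.
Qed.

(** Evaluation at [z * w] is how a coproduct in [dual T] is tested, and the counit of [T] is the
    unit there; the last two clauses are therefore the coproducts prescribed for the generators of
    K. *)
Lemma T421_functionals : exists G X : dual T,
  [/\ forall (m : 'I_2) (l : nat), G (x ^+ m * g ^+ l) = (m == 0)%:R * zeta ^+ l,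
      forall (m : 'I_2) (l : nat), X (x ^+ m * g ^+ l) = (m == 1)%:R,
      forall (f : dual T) (j : nat) (m : 'I_2) (l : nat),
        (f * G ^+ j) (x ^+ m * g ^+ l) = f (x ^+ m * g ^+ l) * zeta ^+ (j * l),
      forall z w, G (z * w) = G z * G w - 2 * ((X * G ^+ 3) z * (X * G) w) &
      forall z w, X (z * w) = (G ^+ 2) z * X w + X z * counit w].
Proof.
(* [G] and [X] are the entries (0, 0) of the representation with [c = zeta] and (1, 0) of
   the one with [c = 1]; multiplying out the matrices gives the last two formulas. *)
have [r rE] := T421_rep (prim_expr_order zeta_prim).
have [s sE] := T421_rep (expr1n k 4).
have r_lin i j : linear (fun z => r z i j : k^o) by move=> a u v; rewrite linearP !mxE.
have s_lin i j : linear (fun z => s z i j : k^o) by move=> a u v; rewrite linearP !mxE.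
pose G : dual T := linfun (fun z => r z 0 0 : k^o).
pose X : dual T := linfun (fun z => s z 1 0 : k^o).
have Gr z : G z = r z 0 0 by exact: (linear_linfun (r_lin 0 0)).
have Xs z : X z = s z 1 0 by exact: (linear_linfun (s_lin 1 0)).
have GE (m : 'I_2) l : G (x ^+ m * g ^+ l) = (m == 0)%:R * zeta ^+ l.
  by rewrite Gr; have [] := rE m l.
have XE (m : 'I_2) l : X (x ^+ m * g ^+ l) = (m == 1)%:R.
  by rewrite Xs; have [_ _ -> _] := sE m l; rewrite expr1n mulr1.
have GXE (f : dual T) j (m : 'I_2) l :
    (f * G ^+ j) (x ^+ m * g ^+ l) = f (x ^+ m * g ^+ l) * zeta ^+ (j * l).
  elim: j => [|j IHj]; first by rewrite mul0n !expr0 !mulr1.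
  rewrite exprSr mulrA mulSn addnC exprD mulrA -{}IHj.
  have := GE 0 l; have := GE 1 l; rewrite !mul1r mul0r expr1 => G1 G0.
  case: m => -[|[|//]] lt_m /=; first by rewrite !mul1r T421_dualM_grouplike G0.
  (* [G] vanishes on [x * g ^+ l], so only the second term of the skew coproduct survives. *)
  by rewrite expr1 T421_dualM_skew G0 G1 mulr0 add0r.
have r10 : (fun z => r z 1 0) =1 (X * G).
  apply: T421_linear_eq => [||m l]; [exact: r_lin|exact: linearP|].
  rewrite -[G]expr1 GXE XE mul1n.
  by have [_ _ -> _] := rE m l.
(* Here zeta^2 - 1 = -2 and -zeta = zeta^3: this is the origin of the coefficient -2 and of the
   exponent 3 in the coproduct of [G]. *)
have r01 : (fun z => r z 0 1) =1 (fun z => -2 * (X * G ^+ 3) z).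
  apply: T421_linear_eq => [|a u v|m l]; first exact: r_lin.
    by rewrite linearP mulrDr scalerAr.
  rewrite GXE XE; have [_ _ _ ->] := rE m l.
  rewrite mulrCA prim4_sqr exprM exprS prim4_sqr mulrN1.
  by rewrite -opprD -mulr2n.
have s00 : (fun z => s z 0 0) =1 counit.
  apply: T421_linear_eq => [||m l]; [exact: s_lin|exact: counit_linear|].
  by rewrite T421_counit; have [-> _ _ _] := sE m l; rewrite expr1n mulr1.
(* At c = 1 this entry is (-1)^l on [g ^+ l], and -1 = zeta^2. *)
have s11 : (fun z => s z 1 1) =1 (G ^+ 2).
  apply: T421_linear_eq => [||m l]; [exact: s_lin|exact: linearP|].
  rewrite -[G ^+ 2]mul1r GXE dual_oneE T421_counit.
  by have [_ -> _ _] := sE m l; rewrite exprM prim4_sqr.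
exists G, X; split=> // z w.
  rewrite Gr rmorphM mxE big_ord_recl big_ord1 -!Gr.
  have -> : lift ord0 0 = 1 :> 'I_2 by exact: val_inj.
  by rewrite [r z 0 1]r01 [r w 1 0]r10 mulNr mulrA mulNr.
rewrite Xs rmorphM mxE big_ord_recl big_ord1 addrC.
have -> : lift ord0 0 = 1 :> 'I_2 by exact: val_inj.
by rewrite [s w 0 0]s00 [s z 1 1]s11 -!Xs.
Qed.

End DualT421.

(** * Algebra maps respecting coproducts, and the pairings they induce *)

Section ComulMorph.
Variables (k : fieldType) (H L : hopfAlgType k) (f : {lrmorphism H -> L}).

Definition comul_compatible (u : H) : Prop :=
  tensor_eq (comul (f u)) [seq (f p.1, f p.2) | p <- comul u].

Lemma tensor_eq_map (s t : seq (H * H)) :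
  tensor_eq s t ->
  tensor_eq [seq (f p.1, f p.2) | p <- s] [seq (f p.1, f p.2) | p <- t].
Proof.
move=> st W b; rewrite !big_map /=.
apply: (bilinear_tensor_eq (b := fun y z => b (f y) (f z)) st).
- by move=> z c y y'; rewrite linearP linearPl.
- by move=> y c z z'; rewrite linearP linearPr.
Qed.

(** With the next three lemmas, the compatible elements form a subalgebra, so compatibility can be
    checked on generators. *)
Lemma comul_compatible_linear c u v :
  comul_compatible u -> comul_compatible v -> comul_compatible (c *: u + v).
Proof.
move=> fu fv W b; rewrite (tensor_eq_map (comul_linear c u v) b) linearP.
rewrite (comul_linear c (f u) (f v) _ b) map_cat !big_cat (fv _ b); congr (_ + _).
rewrite -map_comp !big_map /=.
have sc (M : hopfAlgType k) (s : seq (M * M)) (b' : {bilinear M -> M -> W}) :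
    \sum_(p <- s) b' (c *: p.1) p.2 = c *: \sum_(p <- s) b' p.1 p.2.
  by rewrite scaler_sumr; apply: eq_bigr => p _; rewrite linearZl_LR.
rewrite sc (fu _ b) big_map scaler_sumr; apply: eq_bigr => p _ /=.
by rewrite linearZ linearZl_LR.
Qed.

Lemma comul_compatible1 : comul_compatible 1.
Proof.
move=> W b; rewrite (tensor_eq_map (comul1 (s := H)) b) /=.
by rewrite !rmorph1 (comul1 (s := L) _ b).
Qed.

Lemma comul_compatibleM u v :
  comul_compatible u -> comul_compatible v -> comul_compatible (u * v).
Proof.
move=> fu fv W b; rewrite (tensor_eq_map (comulM u v) b) rmorphM.
rewrite (tensor_eq_comulM fu fv b) big_map !big_allpairs_dep big_map.
apply: eq_bigr => p _; rewrite big_map; apply: eq_bigr => q _ /=.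
by rewrite !rmorphM.
Qed.

Lemma comul_compatibleX u n : comul_compatible u -> comul_compatible (u ^+ n).
Proof.
move=> fu; elim: n => [|n IHn]; first exact: comul_compatible1.
by rewrite exprS; exact: comul_compatibleM.
Qed.

End ComulMorph.

(** Each axiom of a duality is one property of [f]: multiplicativity and [rmorph1] give those on
    products and 1 in [H], [fD] and [fe] those on products and 1 in [L], and the antipode follows by
    [hopf_morph_antipode]. *)
Lemma dual_morph_duality (k : fieldType) (H : hopfAlgType k) (L : finHopfAlgType k)
    (f : {lrmorphism H -> dual L}) :
    (forall u, comul_compatible f u) -> (forall u, counit (f u) = counit u) ->
  exists2 b : {bilinear H -> L -> k | *%R & *%R},
    forall u z, b u z = f u z & duality b.
Proof.
move=> fD fe; pose b u z : k := f u z.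
have bl z : scalar (b^~ z).
  by move=> c u v; rewrite /b linearP add_lfunE scale_lfunE.
have br u : scalar (b u) by move=> c z w; rewrite /b linearP.
pose B : {bilinear H -> L -> k | *%R & *%R} :=
  HB.pack b (bilinear_isBilinear.Build _ _ _ _ _ _ b (pair bl br)).
have BE u z : B u z = f u z by [].
exists B => //; split=> [u v z|u z w|z|u|u z].
- by rewrite BE rmorphM dual_mulE.
- rewrite BE -dual_comulE.
  transitivity (\sum_(p <- [seq (f p.1, f p.2) | p <- comul u]) p.1 z * p.2 w).
    2: by rewrite big_map.
  apply: (bilinear_tensor_eq (b := fun y y' : dual L => y z * y' w : k^o) (fD u))
    => [y' c y y''|y c y' y''].
  + by rewrite add_lfunE scale_lfunE mulrDl scalerAl.
  + by rewrite add_lfunE scale_lfunE mulrDr scalerAr.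
- by rewrite BE rmorph1 dual_oneE.
- exact: fe.
- by rewrite !BE (hopf_morph_antipode fD fe) dual_antipodeE.
Qed.

(** * Fourier inversion and dimension counts *)

(** A polynomial with at most [n] coefficients [c j] that vanishes at the [n] distinct powers of [z]
    is zero. *)
Lemma prim_root_Fourier_inj (k : fieldType) (n : nat) (z : k) (c : 'I_n -> k) :
    n.-primitive_root z ->
    (forall l : 'I_n, \sum_(j < n) c j * z ^+ (j * l) = 0) ->
  forall j, c j = 0.
Proof.
move=> z_prim c0 j.
(* [insub] turns a natural number below [n] into an index; the default 0 is never reached in [p]. *)
pose p := \poly_(i < n) oapp c 0 (insub i).
have p0 : p = 0.
  apply: (@roots_geq_poly_eq0 _ _ [seq z ^+ l | l : 'I_n]).
  - apply/allP => _ /mapP[l _ ->]; rewrite rootE horner_poly.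
    rewrite -[X in _ == X](c0 l); apply/eqP/eq_bigr => i _.
    by rewrite valK /= -exprM mulnC.
  - rewrite map_inj_uniq ?enum_uniq // => i l /eqP.
    by rewrite (eq_prim_root_expr z_prim) !modn_small // => /eqP/val_inj.
  - by rewrite size_map size_enum_ord size_poly.
by have := coef_poly n (fun i => oapp c 0 (insub i)) j; rewrite -/p p0 coef0 ltn_ord valK.
Qed.

(** [F m l] sees only the coefficients of [u] with first index [m] and returns their Fourier
    transform at [l]. This yields nondegeneracy in either argument of the pairing. *)
Lemma monomials_Fourier_inj (k : fieldType) (zeta : k) (A : falgType k) (g x u : A)
    (F : 'I_2 -> 'I_4 -> A -> k^o) :
    4.-primitive_root zeta -> monomials g x = fullv ->
    (forall m l, linear (F m l)) ->
    (forall m l (i : 'I_2) (j : 'I_4), F m l (x ^+ i * g ^+ j) =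
       (i == m)%:R * zeta ^+ (j * l)) ->
    (forall m l, F m l u = 0) ->
  u = 0.
Proof.
move=> zeta_prim gen F_lin FE.
have /monomialsP[c ->] : u \in monomials g x by rewrite gen memvf.
move=> Fu; suff c0 m l : c m l = 0.
  by apply: big1 => i _; apply: big1 => j _; rewrite c0 scale0r.
move: l; apply: (prim_root_Fourier_inj zeta_prim) => l.
rewrite -[RHS](Fu m l) pair_big (linear_sumZ _ (fun p => c p.1 p.2) _ (F_lin m l)).
rewrite -(pair_big xpredT xpredT
  (fun (i : 'I_2) (j : 'I_4) => c i j *: F m l (x ^+ i * g ^+ j))) /=.
rewrite [RHS](bigD1 m) //= [X in _ + X]big1 => [|i /negPf im].
  by rewrite addr0; apply: eq_bigr => j _; rewrite FE eqxx mul1r.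
by apply: big1 => j _; rewrite FE im mul0r scaler0.
Qed.

Lemma injective_dim_le (k : fieldType) (U V : vectType k) (f : {linear U -> V}) :
  injective f -> (\dim {:U} <= \dim {:V})%N.
Proof.
move=> f_inj; have ker0 : lker (linfun f) == 0%VS.
  by apply/lker0P => u v; rewrite !lfunE => /f_inj.
by rewrite -(limg_dim_eq (f := linfun f)) ?dimvS ?subvf // (eqP ker0) capv0.
Qed.

Lemma injective_dim_bij (k : fieldType) (U V : vectType k) (f : {linear U -> V}) :
  injective f -> (\dim {:V} <= \dim {:U})%N -> bijective f.
Proof.
move=> f_inj leVU; have ker0 : lker (linfun f) == 0%VS.
  by apply/lker0P => u v; rewrite !lfunE => /f_inj.
have img : limg (linfun f) = fullv.
  apply/eqP; rewrite eqEdim subvf limg_dim_eq //.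
  by rewrite (eqP ker0) capv0.
exists (linfun f)^-1%VF => v; first by rewrite -(lfunE f) lker0_lfunK.
by rewrite -(lfunE f) limg_lfunVK // img memvf.
Qed.

(** * The Hopf algebra map from K to the dual of T(4,2,1) *)

Lemma K_counit_monomials (k : fieldType) (zeta : k) (K : hopfAlgType k) (G X : K)
    (K_GX : is_K zeta G X) (i : 'I_2) (j : nat) :
  counit (X ^+ i * G ^+ j) = (i == 0)%:R.
Proof.
have eM : {morph (counit : K -> k) : u v / u * v >-> u * v} := counitM.
have eX (u : K) n : counit (u ^+ n) = counit u ^+ n.
  by elim: n => [|n IHn]; [exact: counit1 | rewrite !exprS eM IHn].
rewrite eM !eX (K_counitX K_GX) (K_counitG K_GX) expr1n mulr1 expr0n.
by move: i; exact: ord2_ind.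
Qed.

Lemma K_to_dual_T421 (k : fieldType) (zeta : k) (zeta_prim : 4.-primitive_root zeta)
    (T : finHopfAlgType k) (g x : T) (T_gx : is_T421 g x)
    (K : finHopfAlgType k) (G X : K) (K_GX : is_K zeta G X) :
  exists f : {lrmorphism K -> dual T},
  [/\ forall u, comul_compatible f u, forall u, counit (f u) = counit u &
      forall (i m : 'I_2) (j l : nat), f (X ^+ i * G ^+ j) (x ^+ m * g ^+ l) =
        (i == m)%:R * zeta ^+ (j * l)].
Proof.
have [G' [X' [GE XE GXE GD XD]]] := T421_functionals T_gx zeta_prim.
have dual_eq (p q : dual T) :
    (forall (m : 'I_2) (l : nat), p (x ^+ m * g ^+ l) = q (x ^+ m * g ^+ l)) -> p = q.
  move=> pq; apply/lfunP; apply: (T421_linear_eq T_gx) => //; exact: linearP.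
have GE' j (m : 'I_2) l : (G' ^+ j) (x ^+ m * g ^+ l) = (m == 0)%:R * zeta ^+ (j * l).
  by rewrite -[G' ^+ j]mul1r GXE dual_oneE (T421_counit T_gx).
have G0 l : G' (g ^+ l) = zeta ^+ l by have := GE 0 l; rewrite !mul1r.
have X0 l : X' (g ^+ l) = 0 by have := XE 0 l; rewrite mul1r.
have X1 l : X' (x * g ^+ l) = 1 by have := XE 1 l; rewrite expr1.
have rel : K_rel zeta G' X'.
  split; apply: dual_eq => m l.
  - rewrite GE' dual_oneE (T421_counit T_gx).
    by rewrite exprM (prim_expr_order zeta_prim) expr1n mulr1.
  (* Every term in the coproduct of a monomial has a power of [g] as a factor, and [X'] vanishes on
     those. *)
  - rewrite zero_lfunE; move: m; apply: ord2_ind.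
      by rewrite mul1r (T421_dualM_grouplike T_gx) X0 mulr0.
    by rewrite expr1 (T421_dualM_skew T_gx) !X0 mul0r mulr0 addr0.
  (* On [x * g ^+ l], [G' * X'] evaluates [G'] at [g ^+ l.+1], while [X' * G'] evaluates it at
     [g ^+ l]; the shift produces the factor zeta. *)
  - rewrite scale_lfunE -[X in X' * X]expr1 GXE XE mul1n.
    move: m; apply: ord2_ind.
      by rewrite mul1r (T421_dualM_grouplike T_gx) X0 mulr0 mul0r scaler0.
    by rewrite expr1 (T421_dualM_skew T_gx) X0 X1 G0 mulr0 addr0 mulr1 mul1r exprS.
have [_ /(_ _ _ _ rel)[f [fG fX]] _] := K_presented K_GX.
have fE i j : f (X ^+ i * G ^+ j) = X' ^+ i * G' ^+ j.
  by rewrite rmorphM !rmorphXn -fG -fX.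
have K_span := K_monomials (K_presented K_GX).
have fmE (i m : 'I_2) (j l : nat) :
    f (X ^+ i * G ^+ j) (x ^+ m * g ^+ l) = (i == m)%:R * zeta ^+ (j * l).
  rewrite fE; move: i; apply: ord2_ind; first by rewrite mul1r GE' eq_sym.
  by rewrite expr1 GXE XE eq_sym.
exists f; split=> //.
- have fcG : comul_compatible f G.
    move=> W b; rewrite (tensor_eq_map f (K_comulG K_GX) b) /=.
    apply: dual_tensor_eq => z w; rewrite dual_comulE.
    rewrite big_cons big_seq1 /=.
    have XGE j : f (X * G ^+ j) = X' * G' ^+ j by rewrite -[X in LHS]expr1 fE.
    have -> : f (-2 *: (X * G ^+ 3)) = -2 *: (X' * G' ^+ 3) by rewrite linearZ -XGE.
    have -> : f (X * G) = X' * G' by rewrite -[G in LHS]expr1 XGE.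
    by rewrite -[f G]/(f G : dual T) fG GD scale_lfunE -mulNr mulrA.
  have fcX : comul_compatible f X.
    move=> W b; rewrite (tensor_eq_map f (K_comulX K_GX) b) /=.
    apply: dual_tensor_eq => z w; rewrite dual_comulE.
    rewrite big_cons big_seq1 /=.
    have fG2 : f (G ^+ 2) = G' ^+ 2 by rewrite rmorphXn -fG.
    by rewrite fG2 rmorph1 (dual_oneE w) -[f X]/(f X : dual T) fX XD.
  apply: (monomials_ind K_span) => [c u v fu fv|i j].
    exact: (comul_compatible_linear c fu fv).
  by apply: comul_compatibleM; apply: comul_compatibleX.
- apply: (monomials_ind K_span) => [c u v fu fv|i j].
    by rewrite linearP !counit_linear fu fv.
  (* The counit of [dual T] is evaluation at 1, the monomial with both exponents 0. *)
  rewrite (K_counit_monomials K_GX) -[counit _]/(f (X ^+ i * G ^+ j) 1).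
  by have := fmE i 0 j 0; rewrite mul1r expr0 => ->; rewrite muln0 mulr1.
Qed.

(** * The perfect duality and the isomorphism *)

Lemma dim_linear_forms (k : fieldType) (V : vectType k) :
  \dim {:'Hom(V, k^o)} = \dim {:V}.
Proof. by rewrite !dimvf -[RHS]muln1. Qed.

Theorem proposition5p4 (k : closedFieldType) (k_char0 : [pchar k] =i pred0)
    (zeta : k) (zeta_prim : 4.-primitive_root zeta)
    (T : finHopfAlgType k) (g x : T) (T_gx : is_T421 g x)
    (K : finHopfAlgType k) (G X : K) (K_GX : is_K zeta G X) :
  (exists b : {bilinear K -> T -> k | *%R & *%R},
     [/\ on_bases zeta G X g x b,
         forall b' : {bilinear K -> T -> k | *%R & *%R},
           on_bases zeta G X g x b' -> b' =2 b &
         perfect_duality b]) /\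
  hopf_isomorphic (dual T) K.
Proof.
have T_span := T421_monomials (T421_presented T_gx).
have K_span := K_monomials (K_presented K_GX).
have [f [fD fe fE]] := K_to_dual_T421 zeta_prim T_gx K_GX.
(* [f_inj] and [f_injr] are the nondegeneracy of the pairing on the left and on the right. *)
have f_inj u : (forall z, f u z = 0) -> u = 0.
  move=> fu; apply: (monomials_Fourier_inj zeta_prim K_span
    (F := fun m l v => f v (x ^+ m * g ^+ l))) => [m l c v w|m l i j|m l].
  - by rewrite linearP add_lfunE scale_lfunE.
  - by rewrite fE.
  - exact: fu.
have f_injr z : (forall u, f u z = 0) -> z = 0.
  move=> fz; apply: (monomials_Fourier_inj zeta_prim T_span
    (F := fun i j w => f (X ^+ i * G ^+ j) w)) => [i j|i j m l|i j].
  - exact: linearP.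
  - by rewrite fE eq_sym mulnC.
  - exact: fz.
split.
  have [b bE b_dual] := dual_morph_duality fD fe.
  exists b; split=> [i m j l|b' b'E|]; first by rewrite bE fE.
    move=> u z; move: u; apply: (monomials_ind K_span) => [c u v bu bv|i j].
      by rewrite !linearPl bu bv.
    move: z; apply: (monomials_ind T_span) => [c z w bz bw|m l].
      by rewrite !linearPr bz bw.
    by rewrite b'E bE fE.
  split=> // [u v buv|z w bzw]; apply/eqP; rewrite -subr_eq0; apply/eqP.
    by apply: f_inj => z; rewrite -bE linearBl buv subrr.
  by apply: f_injr => u; rewrite -bE linearBr /= bzw subrr.
have bij : bijective f.
  have inj : injective f.
    move=> u v fuv; apply/eqP; rewrite -subr_eq0; apply/eqP; apply: f_inj => z.
    have -> : f (u - v) = 0 by apply/eqP; rewrite rmorphB subr_eq0; apply/eqP.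
    exact: zero_lfunE.
  apply: (injective_dim_bij inj).
  (* Right nondegeneracy embeds [T] into the linear forms on [K], so dim T is at most dim K; this is
     the inequality that makes the injective [f] bijective. *)
  pose F z : 'Hom(K, k^o) := linfun (fun u => f u z : k^o).
  have FE z u : F z u = f u z.
    by rewrite linear_linfun // => c v w; rewrite linearP add_lfunE scale_lfunE.
  have F_lin : linear F.
    by move=> c z w; apply/lfunP => u; rewrite add_lfunE scale_lfunE !FE linearP.
  pose F' : {linear T -> 'Hom(K, k^o)} := HB.pack F (GRing.isLinear.Build _ _ _ _ _ F_lin).
  have F_inj : injective F'.
    move=> z w Fzw; apply/eqP; rewrite -subr_eq0; apply/eqP; apply: f_injr => u.
    by rewrite linearB /= -!FE -[F]/(F' : T -> _) Fzw subrr.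
  rewrite (dim_linear_forms T : \dim {:dual T} = \dim {:T}) -(dim_linear_forms K).
  exact: injective_dim_le F_inj.
exact: hopf_isomorphic_inv bij fD fe.
Qed.
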